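(* For $\Delta\in\{2,\dots,7\}$, \[ \tau_3(S_\Delta)=\tau_3(T_\Delta)=\begin{cases}8 & \Delta=2,\\ 9 & 3\le\Delta\le 4,\\ 10 & 5\le \Delta\le 7.\end{cases} \]
   Context: $S_k$ is the star with $k$ leaves (one center adjacent to $k$ leaves), and $T_k$ is the infinite $k$-regular tree. For an integer $t\ge1$, a $t$-tone coloring of a (possibly infinite) graph $G$ assigns to each vertex $v$ a set $f(v)$ of exactly $t$ colors from a color set $C$ such that $|f(u)\cap f(v)|<d(u,v)$ for all distinct $u,v$, where $d$ is graph distance; $\tau_t(G)$ is the minimum $|C|$ over all such colorings. *)

(* Defs.v *)
From HB Require Import structures.
From mathcomp Require Import all_boot.
Set Implicit Arguments.
Unset Strict Implicit.
Unset Printing Implicit Defensive.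

Record sgraph := SGraph {
  vertex :> eqType;
  edge : rel vertex;
  edge_sym : symmetric edge;
  edge_irrefl : irreflexive edge
}.

(* d(u,v) = d. No d satisfies this when v is unreachable from u, i.e. when
   d(u,v) is infinite. *)
Definition is_dist (G : sgraph) (u v : G) (d : nat) : Prop :=
  (exists p : seq G, [/\ path (@edge G) u p, last u p = v & size p = d]) /\
  (forall p : seq G, path (@edge G) u p -> last u p = v -> d <= size p).

Definition tone_coloring (t : nat) (G : sgraph) (C : finType)
    (f : G -> {set C}) : Prop :=
  (forall v, #|f v| = t) /\
  (forall u v d, u <> v -> is_dist u v d -> #|f u :&: f v| < d).

Definition tone_colorable (t : nat) (G : sgraph) (n : nat) : Prop :=
  exists C : finType, #|C| = n /\ exists f : G -> {set C}, tone_coloring t f.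

(* tau_t(G) = n *)
Definition is_tau (t : nat) (G : sgraph) (n : nat) : Prop :=
  tone_colorable t G n /\ (forall m, tone_colorable t G m -> n <= m).

(* None is the center, the Some i are the leaves. *)
Definition star_edge (k : nat) : rel (option 'I_k) :=
  fun u v => isSome u (+) isSome v.

Lemma star_edge_sym k : symmetric (@star_edge k).
Proof. by move=> u v; rewrite /star_edge addbC. Qed.

Lemma star_edge_irrefl k : irreflexive (@star_edge k).
Proof. by move=> u; rewrite /star_edge addbb. Qed.

Definition star (k : nat) : sgraph :=
  SGraph (@star_edge_sym k) (@star_edge_irrefl k).

(* The k-regular tree as the Cayley graph of the free product of k copies of
   Z/2: vertices are the words over 'I_k with no two equal consecutive letters,
   and the parent of i :: w is w. It is infinite as soon as 2 <= k. *)
Definition reduced (k : nat) (s : seq 'I_k) : bool :=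
  sorted (fun a b => a != b) s.

Definition tree_vertex (k : nat) := {s : seq 'I_k | reduced s}.

Definition tree_child (k : nat) (u v : tree_vertex k) : bool :=
  (val v != [::]) && (behead (val v) == val u).

Definition tree_edge (k : nat) : rel (tree_vertex k) :=
  fun u v => tree_child u v || tree_child v u.

Lemma tree_edge_sym k : symmetric (@tree_edge k).
Proof. by move=> u v; rewrite /tree_edge orbC. Qed.

Lemma tree_edge_irrefl k : irreflexive (@tree_edge k).
Proof.
move=> u; rewrite /tree_edge orbb /tree_child.
case: (val u) => [|i s] //=; apply/eqP => /(congr1 size)/eqP /=.
by rewrite ltn_eqF.
Qed.

Definition regular_tree (k : nat) : sgraph :=
  SGraph (@tree_edge_sym k) (@tree_edge_irrefl k).

(* The next three lemmas check that regular_tree k is connected, k-regular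
   and acyclic. *)
Lemma regular_tree_connected k (u v : regular_tree k) :
  exists2 p, path (@edge (regular_tree k)) u p & last u p = v.
Proof.
pose e := @edge (regular_tree k); pose r : regular_tree k := Sub [::] isT.
have up s (rs : reduced s) :
    exists2 p, path e (Sub s rs) p & last (Sub s rs) p = r.
  elim: s rs => [|i s IHs] ris; first by exists [::] => //; apply: val_inj.
  have rs : reduced s by apply: path_sorted ris.
  have [p ep lp] := IHs rs; exists (Sub s rs :: p) => //=.
  by rewrite ep /e /= /tree_edge /tree_child /= eqxx orbT.
have toroot w : exists2 p, path e w p & last w p = r by case: w => s rs; apply: up.
have [p ep lp] := toroot u; have [q eq lq] := toroot v.
exists (p ++ rev (belast v q)).
  rewrite cat_path ep lp -lq rev_path.
  by rewrite (eq_path (e' := e)) // => x y; apply: edge_sym.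
rewrite last_cat lp; case: q lq {eq} => [|w q] lq //=.
by rewrite rev_cons last_rcons.
Qed.

Lemma regular_tree_regular k (u : regular_tree k) :
  exists s : seq (regular_tree k),
    [/\ uniq s, size s = k & forall v, edge u v = (v \in s)].
Proof.
case: u => s rs.
pose nb i := if s is j :: w then if j == i then w else i :: s else [:: i].
have rnb i : reduced (nb i).
  rewrite /nb; case: (s) rs => [|j w] //= rs.
  by case: eqVneq => [_|ji]; [apply: path_sorted rs | rewrite /= eq_sym ji].
have nb_inj : injective nb.
  rewrite /nb => i i'; case: (s) => [|j w]; first by case.
  case: eqVneq => [<-|_]; case: eqVneq => [<-|_] //; last by case.
    by move/(congr1 size)/eqP; rewrite /= ltn_eqF.
  by move/(congr1 size)/eqP; rewrite /= gtn_eqF.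
pose nbv i : regular_tree k := Sub (nb i) (rnb i).
exists [seq nbv i | i <- enum 'I_k]; split.
- by rewrite map_inj_uniq ?enum_uniq // => i i' /(congr1 val)/nb_inj.
- by rewrite size_map size_enum_ord.
move=> [t rt]; rewrite /= /tree_edge /tree_child /=; apply/idP/mapP.
  case/orP.
    case: t rt => [|i t] //= rit /eqP ts; exists i; first by rewrite mem_enum.
    apply: val_inj; rewrite /= /nb; subst t; case: (s) rit => [|j w] //=.
    by rewrite [j == i]eq_sym => /andP[/negPf-> _].
  case Es: {1 2}s => [|j w] //= /eqP wt; exists j; first by rewrite mem_enum.
  by apply: val_inj; rewrite /= /nb Es eqxx.
case=> i _ /(congr1 val) /= ->; rewrite /nb.
by case: (s) => [|j w] //=; case: (j == i); rewrite /= eqxx ?orbT.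
Qed.

Lemma regular_tree_acyclic k (p : seq (regular_tree k)) :
  ucycle (@edge (regular_tree k)) p -> size p <= 2.
Proof.
pose e := @edge (regular_tree k); case: p => [|x0 p0] // /andP[].
set p := x0 :: p0 => cp up; rewrite leqNgt; apply/negP => sp.
pose sz (x : regular_tree k) := size (val x).
pose N := \max_(x <- p) sz x.
have [x xp Nx] : exists2 x, x \in p & sz x = N.
  rewrite /N /p; elim: (p0) (x0) => [|y q IHq] z.
    by exists z; rewrite ?mem_seq1 // big_seq1.
  have [x xq Nx] := IHq y; rewrite big_cons -Nx.
  case: (leqP (sz z) (sz x)) => _; last first.
    by exists z; rewrite // inE eqxx.
  by exists x; rewrite // inE xq orbT.
have leN y : y \in p -> sz y <= sz x.
  by move=> yp; rewrite Nx; apply: (@leq_bigmax_seq _ p xpredT sz).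
have parent y : y \in p -> e x y -> val y = behead (val x).
  move=> /leN yx /orP[] /andP[]; last by move=> _ /eqP.
  by rewrite /sz in yx; case: (val y) yx => [|i s] //= sx _ /eqP exs;
    rewrite exs ltnn in sx.
have [i q rpq] := rot_to xp.
have memq : x :: q =i p by move=> z; rewrite -rpq mem_rot.
have cq : cycle e (x :: q) by rewrite -rpq rot_cycle.
have uq : uniq (x :: q) by rewrite -rpq rot_uniq.
have sq : 2 < size (x :: q) by rewrite -rpq size_rot.
case: q {rpq} memq cq uq sq => [|y q] //; case/lastP: q => [|q z] // memq.
rewrite /= rcons_path last_rcons => /and3P[exy _ ezx] /and3P[_ yq _] _.
have exz : e x z by rewrite /e edge_sym.
case/negP: yq; rewrite (_ : y = z) ?mem_rcons ?inE ?eqxx //.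
have yp : y \in p by rewrite -memq !inE eqxx orbT.
have zp : z \in p by rewrite -memq !inE mem_rcons inE eqxx !orbT.
by apply: val_inj; rewrite (parent y yp exy) (parent z zp exz).
Qed.

(* Main.v *)
Require Import Defs.
From mathcomp Require Import all_boot zify.
Set Implicit Arguments.
Unset Strict Implicit.
Unset Printing Implicit Defensive.

(** Around a vertex coloured [A], the neighbours carry 3-sets in the complement
    of [A] meeting pairwise in at most one point; a second-moment count of the
    number of such sets through a point bounds the number of colours from below.

    For the upper bound, 2, 4 and 7 lines of the Fano plane fit in 5, 6 and 7
    points, and any two of them meet in exactly one point. Let [g i] be the
    involution of the colours exchanging [A] with the [i]-th line, and colour
    the vertex [w] of the tree with the image of [A] under the product of the
    [g i] along [w]. Then the neighbours of any vertex are coloured by a copy of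
    the line system. Two vertices at distance 3 get distinct sets: on the path
    [u, a, b, v] the sets of [u] and [b] meet, those of [v] and [b] do not. *)

(** Let [r x] count the sets through [x]. Summing [(r x - a) (r x - a - 1) >= 0] over [B], with
    first moment [t * k] and second moment at most [k * (t + k.-1)], gives the bound. It is sharpest
    when the mean of [r] is near [[a, a + 1]]. *)
Lemma packing_bound (C : finType) (k t a : nat) (B : {set C})
    (L : 'I_k -> {set C}) :
    (forall i, #|L i| = t) -> (forall i, L i \subset B) ->
    (forall i j, i != j -> #|L i :&: L j| <= 1) ->
  2 * a * (t * k) <= a * a.+1 * #|B| + k * k.-1.
Proof.
move=> cardL subL interL; pose r x := \sum_i (x \in L i : nat).
have cardB (S : {set C}) : S \subset B -> \sum_(x in B) (x \in S : nat) = #|S|.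
  move=> SB; rewrite -[in RHS](setIidPr SB) -sum1_card big_mkcond [RHS]big_mkcond.
  by apply: eq_bigr => x _; rewrite inE; case: (x \in B); case: (x \in S).
have sum_r : \sum_(x in B) r x = t * k.
  rewrite exchange_big /= (eq_bigr (fun=> t)) => [|i _]; last by rewrite cardB.
  by rewrite sum_nat_const card_ord mulnC.
have sum_r2 : \sum_(x in B) r x * r x <= k * (t + k.-1).
  have -> : \sum_(x in B) r x * r x = \sum_i \sum_j #|L i :&: L j|.
    under eq_bigr => x _.
      rewrite /r big_distrl /=.
      under eq_bigr => i _ do rewrite big_distrr /=.
    over.
    rewrite exchange_big /=; apply: eq_bigr => i _.
    rewrite exchange_big /=; apply: eq_bigr => j _.
    rewrite -cardB ?(subset_trans (subsetIl _ _)) //.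
    by apply: eq_bigr => x _; rewrite inE mulnb.
  rewrite -[k in k * _]card_ord -sum_nat_const; apply: leq_sum => i _.
  rewrite (bigD1 i) //= setIid cardL leq_add2l.
  have -> : k.-1 = \sum_(j < k | j != i) 1.
    by rewrite sum1_card cardC1 card_ord.
  by apply: leq_sum => j ji; rewrite interL // eq_sym.
have sum_le : (2 * a).+1 * (t * k) <= k * (t + k.-1) + a * a.+1 * #|B|.
  rewrite -sum_r big_distrr /=.
  rewrite (leq_trans _ (leq_add sum_r2 (leqnn _))) // [_ * #|B|]mulnC.
  rewrite -sum_nat_const -big_split /=; apply: leq_sum => x _.
  (* (r - a) (r - a - 1) is nonnegative for integers r and a. *)
  by case: (leqP (r x) a) => ra; nia.
by nia.
Qed.

Lemma is_dist_edge (G : sgraph) (u v : G) : edge u v -> is_dist u v 1.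
Proof.
move=> uv; split; first by exists [:: v]; split => //=; rewrite uv.
case=> [|w p] //= _ uv'; by rewrite uv' edge_irrefl in uv.
Qed.

(** * Lower bound from a vertex with [k] pairwise nonadjacent neighbours *)

Section LowerBound.
Variables (G : sgraph) (k : nat) (x : G) (y : 'I_k -> G).
Hypotheses (y_inj : injective y) (xy : forall i, edge x (y i)).
Hypothesis yy : forall i j, ~~ edge (y i) (y j).

Lemma star_is_dist2 i j : i != j -> is_dist (y i) (y j) 2.
Proof.
move=> ij; split.
  by exists [:: x; y j]; split => //=; rewrite xy edge_sym xy.
case=> [|w [|w' p]] //=; first by move=> _ /y_inj eij; rewrite eij eqxx in ij.
by rewrite andbT => + wy; rewrite wy (negPf (yy i j)).
Qed.

Lemma tone_colorable_ge (t n a : nat) : tone_colorable t G n ->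
  t <= n /\ 2 * a * (t * k) <= a * a.+1 * (n - t) + k * k.-1.
Proof.
case=> C [<- [f [cardf tonef]]]; rewrite -{1 3}(cardf x); split.
  exact: max_card.
rewrite (_ : #|C| - _ = #|~: f x|); last by rewrite -(cardsC (f x)) addKn.
apply: (@packing_bound _ _ _ _ _ (f \o y)) => [i|i|i j ij] /=; first exact: cardf.
- have xNy : x <> y i by move=> e; have := xy i; rewrite -e edge_irrefl.
  have := tonef _ _ _ xNy (is_dist_edge (xy i)).
  rewrite ltnS leqn0 cards_eq0 setI_eq0 => dis.
  by rewrite -disjoints_subset disjoint_sym.
- have yNy : y i <> y j by move/y_inj => e; rewrite e eqxx in ij.
  by have := tonef _ _ _ yNy (star_is_dist2 ij).
Qed.

End LowerBound.

(** * Colorings of the star and the tree from [k] involutions *)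

Section UpperBound.
Variables (C : finType) (k : nat) (A : {set C}) (g : 'I_k -> C -> C).
Hypothesis gK : forall i, involutive (g i).
Hypothesis cardA : #|A| = 3.
Hypothesis disA : forall i, [disjoint A & g i @^-1: A].
Hypothesis meetA : forall i j, i != j ->
  #|g i @^-1: A :&: g j @^-1: A| = 1.

Lemma star_tone_colorable : tone_colorable 3 (star k) #|C|.
Proof.
exists C; split => //; exists (fun u => if u is Some i then g i @^-1: A else A).
split; first by case=> [i|] //; rewrite card_preimset //; apply: inv_inj.
move=> u v d uv [[p [up pv pd]] _].
have d_gt0 : 0 < d by case: p up pv pd => [|w p] //= _ _ <-.
have disAI i : A :&: g i @^-1: A = set0 by apply/eqP; rewrite setI_eq0.
case: u v uv up pv => [i|] [j|] // uv up pv; rewrite ?disAI ?cards0 //.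
  rewrite meetA; last by apply/eqP => e; rewrite e in uv.
  by case: p up pv pd => [|[l|] [|w' p]] //= _ _ <-.
by rewrite setIC disAI cards0.
Qed.

(** Taking preimages makes a new head letter [i] act innermost: it replaces [A] by the preimage of
    [A] under [g i]. *)
Let act (s : seq 'I_k) : C -> C := foldr (fun i h => g i \o h) id s.
Let col (u : regular_tree k) : {set C} := act (val u) @^-1: A.

Let act_inj s : injective (act s).
Proof. by elim: s => [|i s IHs] //=; apply: inj_comp => //; apply: inv_inj. Qed.

Let label (u v : regular_tree k) i :=
  val v = i :: val u \/ val u = i :: val v.

Let labelP u v : edge u v -> exists i, label u v i.
Proof.
case/orP => /andP[]; rewrite /label.
  by case: (val v) => [|i s] //= _ /eqP->; exists i; left.
by case: (val u) => [|i s] //= _ /eqP->; exists i; right.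
Qed.

(** The letter labels form a proper edge coloring: [i] cannot lead from [u] to both a child and the
    parent, as the child's word would then begin with [i] twice. *)
Let label_inj u v w i : label u v i -> label u w i -> v = w.
Proof.
case: u v w => [s rs] [s' rs'] [s'' rs''] l1 l2; apply: val_inj => /=.
case: l1 l2 => /= e [] /= e'.
- by rewrite e e'.
- by move: rs'; rewrite e e' /= eqxx.
- by move: rs''; rewrite e' e /= eqxx.
- by move: e'; rewrite e => -[].
Qed.

(** For a child this unfolds [act]; for the parent the two copies of [g i] cancel. *)
Let col_label u v i : label u v i -> col v = act (val u) @^-1: (g i @^-1: A).
Proof.
by case=> e; apply/setP => c; rewrite /col e !inE //= gK.
Qed.

Let card_act s (S : {set C}) : #|act s @^-1: S| = #|S|.
Proof. exact/card_preimset/act_inj. Qed.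

Let col_edge u v : edge u v -> col u :&: col v = set0.
Proof.
case/labelP => i /col_label ->; rewrite /col -preimsetI.
by have /eqP -> : A :&: g i @^-1: A == set0; rewrite ?setI_eq0 ?preimset0.
Qed.

Let col_path2 u m v : edge u m -> edge m v -> u <> v -> #|col u :&: col v| = 1.
Proof.
rewrite edge_sym => /labelP[i mu] /labelP[j mv] uv.
rewrite (col_label mu) (col_label mv) -preimsetI card_act meetA //.
by apply/eqP => e; apply: uv; apply: label_inj mu _; rewrite e.
Qed.

Lemma tree_tone_colorable : tone_colorable 3 (regular_tree k) #|C|.
Proof.
exists C; split => //; exists col.
have card_col u : #|col u| = 3 by rewrite card_act.
split=> // u v d uv [[p [up pv <-]] dmin].
case: p up pv dmin => [|a [|b [|c [|? p]]]] //=.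
- by rewrite andbT => + <- _ => /col_edge ->; rewrite cards0.
- by case/and3P => ua ab _ bv _; rewrite bv in ab; rewrite (col_path2 ua ab).
- case/and4P => ua ab bc _ cv dmin; rewrite cv in bc.
  (* Otherwise the edge from [b] to [v] would be a path of length 1 from [u]. *)
  have ub : u <> b by move=> e; have := dmin [:: v]; rewrite /= e bc => /(_ isT erefl).
  rewrite ltnNge; apply/negP => le3.
  (* Three common colours would exhaust both 3-sets and make them equal. *)
  have sub w : col u :&: col v \subset col w -> col w = col u :&: col v.
    by move=> s; apply/esym/eqP; rewrite eqEcard s card_col.
  have euv : col u = col v.
    by rewrite (sub u (subsetIl _ _)) [RHS](sub v (subsetIr _ _)).
  by have := col_path2 ua ab ub; rewrite euv setIC (col_edge bc) cards0.
- move=> _ _ _; rewrite (@leq_ltn_trans 3) //.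
  by rewrite -(card_col u) subset_leq_card ?subsetIl.
Qed.

End UpperBound.

(* The Fano plane on 3, ..., 9. The order matters: the first two lines avoid
   8 and 9, and the first four avoid 9. *)
Definition fano_line (i : nat) : seq nat :=
  nth [::] [:: [:: 3; 4; 5]; [:: 3; 6; 7]; [:: 4; 6; 8]; [:: 5; 7; 8];
               [:: 3; 8; 9]; [:: 4; 7; 9]; [:: 5; 6; 9]] i.

(** Here [A] is {0, 1, 2}; for a line [l] this is the involution matching [A] with [l] by position
    and fixing all other colours. *)
Definition line_swap (l : seq nat) (x : nat) : nat :=
  if x < 3 then nth 0 l x else if x \in l then index x l else x.

Lemma card_ord_set_count n (P : pred nat) :
  #|[set x : 'I_n | P x]| = count P (iota 0 n).
Proof.
by rewrite cardsE cardE size_filter -enumT -val_enum_ord count_map.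
Qed.

Lemma all_ordP n (P : pred nat) : all P (iota 0 n) -> forall x : 'I_n, P x.
Proof. by move/allP => PP x; apply: PP; rewrite mem_iota ltn_ord. Qed.

(** The hypotheses are boolean so that computation settles them for numerals [k] and [n]. *)
Lemma fano_tone_colorable k n :
    2 < n ->
    all (fun i => all (fun x => [&& line_swap (fano_line i) x < n,
        line_swap (fano_line i) (line_swap (fano_line i) x) == x
      & (x < 3) ==> ~~ (line_swap (fano_line i) x < 3)]) (iota 0 n)) (iota 0 k) ->
    all (fun i => all (fun j => (i != j) ==>
      (count (fun x => (line_swap (fano_line i) x < 3)
                    && (line_swap (fano_line j) x < 3)) (iota 0 n) == 1))
      (iota 0 k)) (iota 0 k) ->
  tone_colorable 3 (star k) n /\ tone_colorable 3 (regular_tree k) n.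
Proof.
case: n => // n n_gt2 swapP meetP.
pose A := [set x : 'I_n.+1 | x < 3].
(* The range check in [swapP] ensures that [inord] never takes its default value. *)
pose g (i : 'I_k) (x : 'I_n.+1) : 'I_n.+1 := inord (line_swap (fano_line i) x).
have {}swapP (i : 'I_k) := all_ordP (all_ordP swapP i).
have gE i x : g i x = line_swap (fano_line i) x :> nat.
  by rewrite inordK //; case/and3P: (swapP i x).
have gK i : involutive (g i).
  by move=> x; apply: val_inj; rewrite /= !gE; case/and3P: (swapP i x) => _ /eqP.
have cardA : #|A| = 3.
  by rewrite (@card_ord_set_count _ (fun x => x < 3)); case: (n) n_gt2 => [|[|m]] //= _;
    rewrite (eq_in_count (a2 := pred0)) ?count_pred0 // => x; rewrite mem_iota /=; lia.
have disA i : [disjoint A & g i @^-1: A].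
  rewrite disjoints_subset; apply/subsetP => x; rewrite !inE gE.
  by case/and3P: (swapP i x) => _ _ /implyP.
have meetA i j : i != j -> #|g i @^-1: A :&: g j @^-1: A| = 1.
  move=> ij; have /implyP/(_ ij)/eqP <- := all_ordP (all_ordP meetP i) j.
  rewrite -card_ord_set_count; congr #|pred_of_set _|.
  by apply/setP => x; rewrite !inE !gE.
rewrite -[n.+1]card_ord; split.
  exact: star_tone_colorable gK cardA disA meetA.
exact: tree_tone_colorable gK cardA disA meetA.
Qed.

Lemma star_tone_colorable_ge k n a : tone_colorable 3 (star k) n ->
  3 <= n /\ 2 * a * (3 * k) <= a * a.+1 * (n - 3) + k * k.-1.
Proof.
by apply: (@tone_colorable_ge (star k) k None Some) => // i j [].
Qed.

Lemma tree_tone_colorable_ge k n a : tone_colorable 3 (regular_tree k) n ->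
  3 <= n /\ 2 * a * (3 * k) <= a * a.+1 * (n - 3) + k * k.-1.
Proof.
pose x : regular_tree k := exist _ [::] isT.
pose y i : regular_tree k := exist _ [:: i] isT.
have y_inj : injective y by move=> i j [].
exact: (@tone_colorable_ge (regular_tree k) k x y y_inj).
Qed.

Theorem theorem6p1 (D : nat) (hD : 2 <= D <= 7) :
  let c := if D == 2 then 8 else if D <= 4 then 9 else 10 in
  is_tau 3 (star D) c /\ is_tau 3 (regular_tree D) c.
Proof.
(* These values make the packing bound fail with [c - 1] colours; at [D = 5], [a = 1] would only
   give [30 <= 32]. *)
move=> c; pose a := if D <= 4 then 1 else 2.
have [star_c tree_c] : tone_colorable 3 (star D) c /\
    tone_colorable 3 (regular_tree D) c.
  by rewrite /c; case: D hD {a c} => [|[|[|[|[|[|[|[|D']]]]]]]] // _;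
    apply: fano_tone_colorable; vm_compute.
have c_le m : 3 <= m -> 2 * a * (3 * D) <= a * a.+1 * (m - 3) + D * D.-1 -> c <= m.
  by rewrite /c /a; case: D hD {star_c tree_c c a} => [|[|[|[|[|[|[|[|D']]]]]]]] //= _; lia.
split; split => // m.
  by case/(star_tone_colorable_ge a); apply: c_le.
by case/(tree_tone_colorable_ge a); apply: c_le.
Qed.
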